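(* Let $t\ge 1$ and let $H_1, H_2, \dots, H_t$ be $3$-uniform hypergraphs with orders greater than $3$ such that each $H_i$ is isomorphic to either a complete $3$-uniform hypergraph or a complete $3$-uniform hypergraph with a single hyperedge removed. Then $$gr(H_1, H_2, \dots, H_t, K_4^{(3)}, K_4^{(3)};3)\ge \left(gr(H_1, H_2, \dots, H_t;3)-1\right)^2+1.$$
   Context: An $r$-uniform hypergraph $H=(V,E)$ consists of a nonempty finite set $V$ of vertices and a set $E$ of hyperedges, which are (distinct) $r$-element subsets of $V$; its order is $|V|$. $K_n^{(r)}$ denotes the complete $r$-uniform hypergraph of order $n$ (every $r$-element subset of the vertex set is a hyperedge). A $t$-coloring of an $r$-uniform hypergraph $H$ is a function $E(H)\to\{1,2,\dots,t\}$. A hypergraph is rainbow under a coloring if all of its hyperedges receive pairwise distinct colors. A Gallai $t$-coloring of $K_n^{(r)}$ is a $t$-coloring that contains no rainbow subhypergraph isomorphic to $K_{r+1}^{(r)}$. For $r$-uniform hypergraphs $H_1,\dots,H_t$, the Gallai-Ramsey number $gr(H_1,\dots,H_t;r)$ is the least natural number $p$ such that every Gallai $t$-coloring of $K_p^{(r)}$ contains, for some $i\in\{1,\dots,t\}$, a (not necessarily induced) subhypergraph isomorphic to $H_i$ all of whose hyperedges have color $i$. Here the number on the left-hand side of the claim involves $t+2$ colors and the one on the right-hand side involves $t$ colors. *)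

(* Defs.v *)
From mathcomp Require Import all_boot.
From mathcomp Require Import boolp.

Set Implicit Arguments.
Unset Strict Implicit.
Unset Printing Implicit Defensive.

(* An empty vertex type is allowed, so that the complete hypergraph [K r n] is
   defined for every n. For families of nonempty hypergraphs this does not
   affect [gr]: no member of the family is contained in [K r 0]. *)
Record hypergraph (r : nat) := Hypergraph {
  vertex :> finType;
  edge : {set {set vertex}};
  edge_uniform : forall e : {set vertex}, e \in edge -> #|e| = r }.

Definition isomorphic r (G H : hypergraph r) : Prop :=
  exists2 f : G -> H, bijective f &
    forall e : {set G}, (f @: e \in edge H) = (e \in edge G).

Lemma K_uniform r n (e : {set 'I_n}) :
  e \in [set e : {set 'I_n} | #|e| == r] -> #|e| = r.
Proof. by rewrite inE => /eqP. Qed.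

Definition K r n : hypergraph r := Hypergraph (@K_uniform r n).

Lemma del_edge_uniform r (H : hypergraph r) (e0 e : {set H}) :
  e \in edge H :\ e0 -> #|e| = r.
Proof. by case/setD1P=> _ /edge_uniform. Qed.

Definition del_edge r (H : hypergraph r) (e0 : {set H}) : hypergraph r :=
  Hypergraph (@del_edge_uniform r H e0).

Record subhypergraph r (H : hypergraph r) := Subhypergraph {
  sub_vertex : {set H};
  sub_edge : {set {set H}};
  sub_edge_subset : sub_edge \subset edge H;
  sub_edge_incident : forall e, e \in sub_edge -> e \subset sub_vertex }.

Section SubhypergraphAsHypergraph.
Variables (r : nat) (H : hypergraph r) (S : subhypergraph H).

Let V := {x : H | x \in sub_vertex S}.

Lemma sub_uniform (e : {set V}) :
  e \in [set e : {set V} | val @: e \in sub_edge S] -> #|e| = r.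
Proof.
rewrite inE => /(subsetP (sub_edge_subset S))/edge_uniform.
by rewrite card_imset //; apply: val_inj.
Qed.

Definition hypergraph_of_sub : hypergraph r := Hypergraph sub_uniform.

End SubhypergraphAsHypergraph.

Coercion hypergraph_of_sub : subhypergraph >-> hypergraph.

(* Only hyperedges are colored; 'I_t plays the role of {1, ..., t}. *)
Definition coloring r (H : hypergraph r) (t : nat) : Type :=
  {e : {set H} | e \in edge H} -> 'I_t.

Definition rainbow r (H : hypergraph r) t (c : coloring H t)
    (S : subhypergraph H) : Prop :=
  forall e1 e2 : {e : {set H} | e \in edge H},
    val e1 \in sub_edge S -> val e2 \in sub_edge S -> c e1 = c e2 -> e1 = e2.

Definition monochromatic r (H : hypergraph r) t (c : coloring H t) (i : 'I_t)
    (S : subhypergraph H) : Prop :=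
  forall e : {e : {set H} | e \in edge H}, val e \in sub_edge S -> c e = i.

Definition gallai r n t (c : coloring (K r n) t) : Prop :=
  forall S : subhypergraph (K r n), isomorphic S (K r r.+1) -> ~ rainbow c S.

Definition gallai_arrows r t (H : 'I_t -> hypergraph r) (p : nat) : Prop :=
  forall c : coloring (K r p) t, gallai c ->
    exists (i : 'I_t) (S : subhypergraph (K r p)),
      isomorphic S (H i) /\ monochromatic c i S.

(* Ramsey's theorem for r-subsets and t colors; it makes [gr] below total. *)
Lemma ramsey r t m : exists N, forall (T : finType) (A : {set T})
    (c : {set T} -> 'I_t), N <= #|A| ->
  exists B : {set T}, exists i : 'I_t,
    [/\ B \subset A, m <= #|B| &
        forall e : {set T}, e \subset B -> #|e| = r -> c e = i].
Proof.
elim: r m => [|r IHr] m.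
  exists m => T A c mA; exists A, (c set0); split=> // e _ /eqP.
  by rewrite cards_eq0 => /eqP->.
have step k : exists N, forall (T : finType) (A : {set T})
    (c : {set T} -> 'I_t), N <= #|A| ->
    exists B : {set T}, exists d : T -> 'I_t,
    [/\ B \subset A, k <= #|B| &
      forall e : {set T}, e \subset B -> #|e| = r.+1 ->
        exists2 x, x \in e & c e = d x].
  elim: k => [|k [N IHk]].
    exists 0 => T A c _; exists set0, (fun=> c set0); split; rewrite ?sub0set //.
    by move=> e; rewrite subset0 => /eqP->; rewrite cards0.
  have [M HM] := IHr N; exists M.+1 => T A c MA.
  have [x xA] : exists x, x \in A by apply/card_gt0P; apply: leq_trans MA.
  have [|A' [i [sA' NA' Hi]]] := HM T (A :\ x) (fun f => c (x |: f)).
    by move: MA; rewrite (cardsD1 x A) xA.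
  have [B [d [sB kB Hd]]] := IHk T A' c NA'.
  have sBA : B \subset A :\ x by apply: subset_trans sA'.
  have xB : x \notin B.
    by apply/negP => /(subsetP sBA); rewrite !inE eqxx.
  exists (x |: B), (fun y => if y == x then i else d y); split.
  - by rewrite subUset sub1set xA /= (subset_trans sBA) ?subD1set.
  - by rewrite cardsU1 xB add1n.
  move=> e se ce; have [xe|xe] := boolP (x \in e).
    exists x => //; rewrite eqxx -(setD1K xe); apply: Hi.
      by apply: subset_trans sB; rewrite subDset.
    by move: ce; rewrite (cardsD1 x e) xe add1n => -[].
  have seB : e \subset B.
    apply/subsetP => y ye; move/(subsetP se): (ye).
    by rewrite !inE; case: eqP => // yx; rewrite -yx ye in xe.
  have [y ye ->] := Hd e seB ce; exists y => //.
  by case: eqP => // yx; rewrite -yx ye in xe.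
have [N HN] := step (t * m); exists N => T A c NA.
have [B [d [sB tB Hd]]] := HN T A c NA.
have [i mi] : exists i : 'I_t, m <= #|[set x in B | d x == i]|.
  apply/existsP; apply: contraT; rewrite negb_exists => /forallP small.
  have t_gt0 : 0 < t by apply: leq_ltn_trans (ltn_ord (c set0)).
  suff: #|B| < t * m by rewrite ltnNge tB.
  have -> : #|B| = \sum_(i < t) #|[set x in B | d x == i]|.
    rewrite -sum1_card (partition_big d predT) //=; apply: eq_bigr => i _.
    by rewrite -sum1_card; apply: eq_bigl => x; rewrite inE.
  have : \sum_(i < t) (#|[set x in B | d x == i]| + 1) <= \sum_(i < t) m.
    by apply: leq_sum => i _; rewrite addn1 ltnNge.
  rewrite big_split /= !sum_nat_const card_ord muln1.
  by apply: leq_trans; rewrite -addn1 leq_add2l.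
exists [set x in B | d x == i], i; split=> //.
  by apply: subset_trans sB; apply/subsetP => x; rewrite inE => /andP[].
move=> e se ce; have [|x xe ->] := Hd e _ ce.
  by apply: subset_trans se _; apply/subsetP => x; rewrite inE => /andP[].
by move/(subsetP se): xe; rewrite inE => /andP[_ /eqP].
Qed.

Lemma copy_sub r (G H : hypergraph r) (f : G -> H) :
    injective f -> (forall e : {set G}, e \in edge G -> f @: e \in edge H) ->
  exists S : subhypergraph H,
    isomorphic S G /\ sub_edge S = [set f @: (e : {set G}) | e in edge G].
Proof.
move=> f_inj f_edge.
have sE : [set f @: (e : {set G}) | e in edge G] \subset edge H.
  by apply/subsetP => _ /imsetP[e eG ->]; apply: f_edge.
have iE e : e \in [set f @: (e : {set G}) | e in edge G] ->
    e \subset f @: [set: G].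
  by case/imsetP=> e' _ ->; apply: imsetS; apply: subsetT.
exists (Subhypergraph sE iE); split=> //.
set S := Subhypergraph sE iE.
have fS x : f x \in sub_vertex S by apply: imset_f; rewrite inE.
pose g (x : G) : S := exist _ (f x) (fS x).
have g_inj : injective g by move=> x y /(congr1 val)/f_inj.
have gP (y : S) : exists x, g x == y.
  have /imsetP[x _ yx] := valP y.
  by exists x; apply/eqP/val_inj; rewrite /= yx.
pose h y := xchoose (gP y).
have hK : cancel h g by move=> y; apply/eqP/(xchooseP (gP y)).
have gK : cancel g h by move=> x; apply: g_inj; rewrite hK.
exists h; first by exists g.
move=> e; rewrite [RHS]inE.
have -> : val @: e = f @: (h @: e).
  rewrite -!imset_comp; apply: eq_imset => y /=.
  by rewrite -[in LHS](hK y).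
by rewrite mem_imset //; apply: imset_inj.
Qed.

Lemma gr_exists r t (H : 'I_t -> hypergraph r) :
  exists p, `[< gallai_arrows H p >].
Proof.
have [N HN] := ramsey r t (\sum_i #|H i|).
exists (N + r); apply/asboolP => c _.
have [e0 e0K] : exists e : {set K r (N + r)}, e \in edge (K r (N + r)).
  have [e _ ce] : exists2 e : {set 'I_(N + r)}, e \subset [set: 'I_(N + r)]
      & #|e| = r.
    have : 0 < #|[set e : {set 'I_(N + r)} | (e \subset setT) && (#|e| == r)]|.
      by rewrite cards_draws cardsT card_ord bin_gt0 leq_addl.
    by case/card_gt0P=> e; rewrite inE => /andP[? /eqP]; exists e.
  by exists e; rewrite inE ce.
pose c' (e : {set 'I_(N + r)}) : 'I_t :=
  if @insub _ (fun e => e \in edge (K r (N + r))) _ e is Some u then c u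
  else c (exist _ e0 e0K).
have [|B [i [_ mB HB]]] := HN _ [set: 'I_(N + r)] c'.
  by rewrite cardsT card_ord leq_addr.
have HiB : #|H i| <= #|B|.
  by apply: leq_trans mB; rewrite (bigD1 i) //= leq_addr.
pose f (x : H i) : K r (N + r) := enum_val (widen_ord HiB (enum_rank x)).
have f_inj : injective f.
  by move=> x y /enum_val_inj/(congr1 val)/= /val_inj/enum_rank_inj.
have [|S [iS ES]] := copy_sub f_inj.
  by move=> e /edge_uniform ce; rewrite inE card_imset // ce.
exists i, S; split=> // e; rewrite ES => /imsetP[e' e'H Ee].
have ce : #|val e| = r by apply: edge_uniform (valP e).
have <- : c' (val e) = c e by rewrite /c' valK.
apply: HB => //; rewrite Ee; apply/subsetP => _ /imsetP[x _ ->].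
exact: enum_valP.
Qed.

Definition gr r t (H : 'I_t -> hypergraph r) : nat := ex_minn (gr_exists H).

Definition cat_family r s t (G : 'I_s -> hypergraph r)
    (H : 'I_t -> hypergraph r) (i : 'I_(s + t)) : hypergraph r :=
  match split i with inl j => G j | inr j => H j end.

(* Main.v *)
Require Import Defs.
From mathcomp Require Import all_boot.
From mathcomp Require Import boolp zify.

(** Put [m := gr H - 1] and take a Gallai [t]-coloring [d] of the triples of an
    [m]-element set with no copy of [H i] in color [i].  Blow it up to the
    [m ^ 2] points of ['I_m * 'I_m], whose blocks are the fibers of [fst]
    ([block_coloring]): a triple inside one block is colored by [d] through
    its second coordinates, a triple meeting three blocks is colored by [d]
    through its first coordinates, and a triple meeting exactly two blocks
    gets one of the two new colors, according to whether the block holding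
    two of its points is the lower one.

    This coloring is Gallai ([block_gallai]).  Four points in one block or in
    four different blocks form a copy of a quadruple of [d].  Otherwise some
    [x], [y] share a block that misses some [z], and wherever the fourth point
    lies, two of the four triples agree.

    There is no [K 3 4] in a new color ([block_no_new_copy]): all four triples
    would meet exactly two blocks, so the points are split two and two, and
    such a quadruple sees both new colors.

    There is no [H i] in an old color [i] ([block_no_old_copy]): a triple
    meeting exactly two blocks has a new color, so it can only be the missing
    hyperedge of [H i].  As [H i] has a fourth vertex, two vertices of [H i]
    in one block and one outside would produce a second such triple.  Hence a
    projection is injective on the copy, and moves it to a copy in [d].

    Restricting to [p <= m ^ 2] points shows that [p] points do not suffice. *)

Set Implicit Arguments.
Unset Strict Implicit.
Unset Printing Implicit Defensive.

(** * Colorings defined on all vertex sets *)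

Definition draws (V : finType) r (Q : {set V}) : {set {set V}} :=
  [set e : {set V} | (e \subset Q) && (#|e| == r)].

(** Only the values on [r]-sets matter: coloring every set of vertices lets
    colorings be pulled back along maps without carrying proofs around.
    Stating the condition as a failure of injectivity makes it transport
    along injections. *)
Definition set_gallai r (V : finType) C (d : {set V} -> C) : Prop :=
  forall Q : {set V}, #|Q| = r.+1 -> ~ {in draws r Q &, injective d}.

Definition mono_copy r (G : hypergraph r) (V : finType) C
    (d : {set V} -> C) (i : C) : Prop :=
  exists2 g : G -> V, injective g &
    forall e : {set G}, e \in edge G -> d (g @: e) = i.

Lemma sub_imset_preim (aT rT : finType) (h : aT -> rT) (Q : {set aT})
    (e : {set rT}) : e \subset h @: Q -> h @: (Q :&: h @^-1: e) = e.
Proof.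
move=> se; apply/setP=> y; apply/imsetP/idP => [[x]|ye].
  by rewrite !inE => /andP[_ xe] ->.
have /imsetP[x xQ yx] := subsetP se y ye.
by exists x; rewrite // !inE xQ -yx.
Qed.

Lemma draws_imset r (aT rT : finType) (h : aT -> rT) (Q : {set aT})
    (e : {set rT}) :
    {in Q &, injective h} -> e \in draws r (h @: Q) ->
  exists2 e', e' \in draws r Q & e = h @: e'.
Proof.
move=> h_inj; rewrite inE => /andP[se /eqP ce]; exists (Q :&: h @^-1: e).
  rewrite inE subsetIl -ce -[in X in _ == X](sub_imset_preim se).
  rewrite card_in_imset ?eqxx // => x y; rewrite !inE => /andP[xQ _] /andP[yQ _].
  exact: h_inj.
by rewrite sub_imset_preim.
Qed.

(** [h] need only be injective on [Q]: the two projections of the block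
    coloring are injective on some quadruples only. *)
Lemma set_gallai_in r (V W : finType) C (h : V -> W) (d : {set W} -> C)
    (Q : {set V}) :
    set_gallai r d -> #|Q| = r.+1 -> {in Q &, injective h} ->
  ~ {in draws r Q &, injective (fun e : {set V} => d (h @: e))}.
Proof.
move=> dG cQ h_inj d_inj; apply: (dG (h @: Q)); first by rewrite card_in_imset.
move=> _ _ /(draws_imset h_inj)[e1 e1Q ->] /(draws_imset h_inj)[e2 e2Q ->].
by move/d_inj->.
Qed.

Lemma set_gallai_pullback r (V W : finType) C (h : V -> W) (d : {set W} -> C) :
  injective h -> set_gallai r d -> set_gallai r (fun e : {set V} => d (h @: e)).
Proof. by move=> h_inj dG Q cQ; apply: set_gallai_in => // x y _ _ /h_inj. Qed.

Lemma mono_copy_pullback r (G : hypergraph r) (V W : finType) C (h : V -> W)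
    (d : {set W} -> C) i :
  injective h -> mono_copy G (fun e : {set V} => d (h @: e)) i -> mono_copy G d i.
Proof.
move=> h_inj [g g_inj gP]; exists (h \o g); first exact: inj_comp.
by move=> e /gP; rewrite imset_comp.
Qed.

(** Converse of [copy_sub]. *)
Lemma sub_copy r (G H : hypergraph r) (S : subhypergraph H) :
    isomorphic S G ->
  exists2 g : G -> H, injective g &
    (forall e : {set G}, e \in edge G -> g @: e \in sub_edge S).
Proof.
case=> f [f' fK f'K] fE; exists (val \o f').
  exact: inj_comp val_inj (can_inj f'K).
move=> e eG; rewrite imset_comp.
have: f' @: e \in edge S.
  by rewrite -fE -imset_comp (eq_imset _ (g := id)) ?imset_id.
by rewrite inE.
Qed.

Lemma sub_edge_val r (H : hypergraph r) (S : subhypergraph H) (e : {set H}) :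
  e \in sub_edge S -> exists u : {e : {set H} | e \in edge H}, val u = e.
Proof. by move/(subsetP (sub_edge_subset S)) => eH; exists (exist _ e eH). Qed.

Lemma K_imset_edge r n (V : finType) (g : 'I_n -> V) (e : {set K r n}) :
  injective g -> e \in edge (K r n) -> #|g @: e| = r.
Proof. by move=> g_inj /edge_uniform; rewrite card_imset. Qed.

Lemma gallai_set_gallai r n t (c : coloring (K r n) t)
    (d : {set 'I_n} -> 'I_t) :
  (forall u, c u = d (val u)) -> gallai c <-> set_gallai r d.
Proof.
move=> cd; split=> [cG Q cQ d_inj | dG S /sub_copy[g g_inj gE] S_rainbow].
  pose g (i : K r r.+1) : K r n := enum_val (cast_ord (esym cQ) i).
  have g_inj : injective g by move=> i j /enum_val_inj/cast_ord_inj.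
  have [|S [SK SE]] := copy_sub g_inj.
    by move=> e eK; rewrite inE K_imset_edge.
  apply: (cG S SK) => e1 e2; rewrite !cd SE.
  case/imsetP=> f1 f1K E1 /imsetP[f2 f2K E2] /d_inj E; apply/val_inj/E.
    rewrite E1 inE K_imset_edge // eqxx andbT.
    by apply/subsetP=> _ /imsetP[x _ ->]; apply: enum_valP.
  rewrite E2 inE K_imset_edge // eqxx andbT.
  by apply/subsetP=> _ /imsetP[x _ ->]; apply: enum_valP.
have cT : #|[set: K r r.+1]| = r.+1 by rewrite cardsT card_ord.
apply: (set_gallai_in dG cT (in2W g_inj)) => e1 e2.
rewrite !inE !subsetT /= => ce1 ce2 E.
have m1 : g @: e1 \in sub_edge S by apply: gE; rewrite inE.
have m2 : g @: e2 \in sub_edge S by apply: gE; rewrite inE.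
have [[u1 E1] [u2 E2]] := (sub_edge_val m1, sub_edge_val m2).
apply: (imset_inj g_inj); rewrite -E1 -E2; congr val.
by apply: S_rainbow; rewrite ?E1 ?E2 // !cd E1 E2.
Qed.

Lemma monochromatic_mono_copy r n t (G : hypergraph r) (c : coloring (K r n) t)
    (d : {set 'I_n} -> 'I_t) i :
    (forall u, c u = d (val u)) ->
  (exists S : subhypergraph (K r n), isomorphic S G /\ monochromatic c i S)
    <-> mono_copy G d i.
Proof.
move=> cd; split=> [[S [/sub_copy[g g_inj gE] Sc]] | [g g_inj gd]].
  exists g => // e /gE m.
  by have [u ue] := sub_edge_val m; rewrite -ue -cd; apply: Sc; rewrite ue.
have [|S [SG SE]] := @copy_sub _ G (K r n) g g_inj.
  by move=> e /edge_uniform ce; rewrite inE card_imset // ce.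
exists S; split=> // u; rewrite SE cd => /imsetP[e eG ->].
exact: gd.
Qed.

(** Turns the arrow relation into a statement about colorings of all vertex
    sets.  A color must exist, to give the sets that are not hyperedges one. *)
Lemma gallai_arrowsE r t (H : 'I_t -> hypergraph r) p : 0 < t ->
  gallai_arrows H p <->
  (forall d : {set 'I_p} -> 'I_t, set_gallai r d ->
     exists i, mono_copy (H i) d i).
Proof.
move=> t_gt0; split=> [arr d dG | arr c cG].
  pose c (u : {e : {set K r p} | e \in edge (K r p)}) := d (val u).
  have cd u : c u = d (val u) by [].
  have /arr[i [S iS]] := (gallai_set_gallai cd).2 dG.
  by exists i; apply/(monochromatic_mono_copy _ _ cd); exists S.
pose d (e : {set K r p}) : 'I_t :=
  if @insub _ (fun e => e \in edge (K r p)) _ e is Some u then c u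
  else Ordinal t_gt0.
have cd u : c u = d (val u) by rewrite /d valK.
have /arr[i /(monochromatic_mono_copy _ _ cd)iS] :=
  (gallai_set_gallai cd).1 cG.
by exists i.
Qed.

(** * Nearly complete hypergraphs *)

(** Treats both shapes at once, since [e0] need not be an [r]-set: for a
    complete hypergraph any [e0] will do. *)
Definition nearly_complete r (G : hypergraph r) : Prop :=
  exists e0 : {set G}, forall e : {set G},
    #|e| = r -> e != e0 -> e \in edge G.

Lemma isomorphic_nearly_complete r (G H : hypergraph r) :
  isomorphic G H -> nearly_complete H -> nearly_complete G.
Proof.
case=> f f_bij fE [e0 He0]; have f_inj := bij_inj f_bij.
have [f' fK f'K] := f_bij.
exists (f' @: e0) => e ce ne; rewrite -fE; apply: He0.
  by rewrite card_imset.
apply: contra ne => /eqP <-.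
by rewrite -imset_comp (eq_imset _ (g := id)) ?imset_id.
Qed.

Lemma K_nearly_complete r n : nearly_complete (K r n).
Proof. by exists set0 => e /eqP ce _; rewrite inE. Qed.

Lemma del_edge_nearly_complete r n (e : {set K r n}) :
  nearly_complete (del_edge e).
Proof. by exists e => f cf ne; rewrite !inE ne cf eqxx. Qed.

(** * Triples *)

Lemma card_set3 (T : finType) (x y z : T) :
  x != y -> x != z -> y != z -> #|[set x; y; z]| = 3.
Proof.
move=> xy xz yz; rewrite setUC cardsU1 cards2 xy !inE negb_or.
by rewrite eq_sym xz eq_sym yz.
Qed.

Lemma imset_set3 (T U : finType) (f : T -> U) x y z :
  f @: [set x; y; z] = [set f x; f y; f z].
Proof. by rewrite !imsetU !imset_set1. Qed.

Lemma set3_neq (T : finType) (x y z u v w : T) :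
  x != u -> x != v -> x != w -> [set x; y; z] != [set u; v; w].
Proof.
move=> xu xv xw; apply/eqP => /setP/(_ x).
by rewrite !inE eqxx (negbTE xu) (negbTE xv) (negbTE xw).
Qed.

Lemma exists_fourth (T : finType) (A : {set T}) (x y z : T) :
  3 < #|A| -> exists2 w, w \in A & [/\ w != x, w != y & w != z].
Proof.
move=> cA; have: 0 < #|A :\ x :\ y :\ z|.
  have := cardsD1 x A; have := cardsD1 y (A :\ x).
  have := cardsD1 z (A :\ x :\ y).
  lia.
by case/card_gt0P=> w; rewrite !inE => /and4P[]; exists w.
Qed.

(** * The block coloring *)

(** The three ways a set can meet the blocks, used for quadruples of points
    and for copies of a hypergraph alike. *)
Lemma fiber_cases (T : finType) (U : eqType) (f : T -> U) (Q : {set T}) :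
  [\/ {in Q &, injective f}, {in Q &, forall x y, f x = f y} |
    exists x y z, [/\ x \in Q, y \in Q, z \in Q, x != y &
                       f x = f y /\ f z != f x]].
Proof.
have [/dinjectiveP f_inj|] := boolP (dinjectiveb f Q); first by constructor 1.
case/dinjectivePn=> x xQ [y /andP[yx yQ] fxy].
have [/forall_inP fQ|/forall_inPn[z zQ fz]] := boolP [forall z in Q, f z == f x].
  by constructor 2 => u v /fQ/eqP -> /fQ/eqP ->.
by constructor 3; exists x, y, z; split; rewrite // eq_sym.
Qed.

Section BlockColoring.

Variables (m t : nat) (d : {set 'I_m} -> 'I_t).
Implicit Types (x y z w : 'I_m * 'I_m) (e Q : {set 'I_m * 'I_m}).

(** The name is meant for triples that meet exactly two blocks; which of the
    two blocks holds the pair must decide the color, or else a quadruple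
    split two and two would be monochromatic. *)
Definition pair_below e : bool :=
  [exists x in e, exists y in e, exists z in e,
    [&& x != y, x.1 == y.1 & x.1 < z.1]].

Definition block_coloring e : 'I_(t + 2) :=
  if #|fst @: e| == 1 then lshift 2 (d (snd @: e))
  else if #|fst @: e| == 2 then
    rshift t (if pair_below e then ord0 else ord_max)
  else lshift 2 (d (fst @: e)).

Lemma block_coloring_inside Q e :
    {in Q &, forall x y, x.1 = y.1} -> e \in draws 3 Q ->
  block_coloring e = lshift 2 (d (snd @: e)).
Proof.
move=> Q_block; rewrite inE => /andP[/subsetP se /eqP ce].
have [x xe] : exists x, x \in e by apply/card_gt0P; rewrite ce.
suff E : fst @: e = [set x.1] by rewrite /block_coloring E cards1.
apply/setP=> a; rewrite inE; apply/imsetP/eqP => [[y ye ->]|->].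
  by apply: Q_block; apply: se.
by exists x.
Qed.

Lemma block_coloring_across Q e :
    {in Q &, injective fst} -> e \in draws 3 Q ->
  block_coloring e = lshift 2 (d (fst @: e)).
Proof.
move=> Q_inj; rewrite inE => /andP[/subsetP se /eqP ce].
by rewrite /block_coloring card_in_imset ?ce // => x y /se xQ /se; apply: Q_inj.
Qed.

Lemma block_coloring_split x y z :
    x != y -> x.1 = y.1 -> z.1 != x.1 ->
  block_coloring [set x; y; z] = rshift t (if x.1 < z.1 then ord0 else ord_max).
Proof.
move=> xy fxy zx; rewrite /block_coloring imset_set3 -fxy setUid cards2.
rewrite [x.1 == _]eq_sym (negbTE zx) /=; congr (rshift t (if _ then _ else _)).
apply/idP/idP => [|lt_xz].
  case/exists_inP=> u uE /exists_inP[v vE /exists_inP[w wE]] /and3P[].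
  move: uE vE wE; rewrite !inE -!orbA => uE vE wE uv /eqP fuv.
  have fux : u.1 = x.1.
    case/or3P: uE uv fuv => /eqP->; rewrite ?fxy //.
    by case/or3P: vE => /eqP->; rewrite ?eqxx ?fxy.
  by case/or3P: wE => /eqP->; rewrite fux -?fxy ?ltnn.
apply/exists_inP; exists x; first by rewrite !inE eqxx.
apply/exists_inP; exists y; first by rewrite !inE eqxx orbT.
apply/exists_inP; exists z; first by rewrite !inE eqxx !orbT.
by rewrite xy fxy eqxx -fxy.
Qed.

Lemma set3_draws Q x y z :
    x \in Q -> y \in Q -> z \in Q -> x != y -> x != z -> y != z ->
  [set x; y; z] \in draws 3 Q.
Proof.
move=> xQ yQ zQ xy xz yz; rewrite inE card_set3 // eqxx andbT.
by rewrite !subUset !sub1set xQ yQ zQ.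
Qed.

Lemma block_coloring_three x y z :
    x.1 != y.1 -> x.1 != z.1 -> y.1 != z.1 ->
  block_coloring [set x; y; z] = lshift 2 (d [set x.1; y.1; z.1]).
Proof.
by move=> xy xz yz; rewrite /block_coloring imset_set3 card_set3.
Qed.

Lemma neq_fst x y : x.1 != y.1 -> x != y.
Proof. by apply: contraNneq => ->. Qed.

(** Outside the two cases inherited from [d], the position of the fourth point
    [w] tells which two triples agree: [x], [y] and [w], [x] are pairs of the
    same block against [z]; or [z], [w] share a block, and the pair [x], [y]
    faces either of them; or [x] and [y] are interchangeable next to [z], [w],
    as only blocks count for a triple meeting three of them. *)
Lemma block_gallai : set_gallai 3 d -> set_gallai 3 block_coloring.
Proof.
move=> dG Q cQ c_inj.
have [Q_inj|Q_block|[x [y [z [xQ yQ zQ xy [fxy fz]]]]]] := fiber_cases fst Q.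
- apply: (set_gallai_in dG cQ Q_inj) => e1 e2 e1Q e2Q E; apply: c_inj => //.
  by rewrite !(block_coloring_across Q_inj) // E.
- have snd_inj : {in Q &, injective snd}.
    move=> [x1 x2] [y1 y2] xQ yQ /= ->.
    by have /= -> := Q_block _ _ xQ yQ.
  apply: (set_gallai_in dG cQ snd_inj) => e1 e2 e1Q e2Q E; apply: c_inj => //.
  by rewrite !(block_coloring_inside Q_block) // E.
have [|w wQ [wx wy wz]] := @exists_fourth _ Q x y z; first by rewrite cQ.
have fzy : z.1 != y.1 by rewrite -fxy.
have [zx zy] := (neq_fst fz, neq_fst fzy).
have [fwx|fwx] := eqVneq w.1 x.1.
  have : [set y; x; z] = [set w; x; z].
    apply: c_inj; try by apply: set3_draws; rewrite // eq_sym.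
    by rewrite !block_coloring_split ?fwx -?fxy // eq_sym.
  by apply/eqP/set3_neq; rewrite // eq_sym.
have [fwz|fwz] := eqVneq w.1 z.1.
  have : [set z; x; y] = [set w; x; y].
    apply: c_inj; try by apply: set3_draws.
    by rewrite -!setUA !(setUC [set _] (_ :|: _)) !block_coloring_split ?fwz.
  by apply/eqP/set3_neq; rewrite // eq_sym.
have : [set x; z; w] = [set y; z; w].
  apply: c_inj; try by apply: set3_draws; rewrite // eq_sym.
  by rewrite !block_coloring_three -?fxy // eq_sym.
by apply/eqP/set3_neq; rewrite // eq_sym.
Qed.

(** A quadruple all of whose triples meet exactly two blocks is split two and
    two; the pair in the lower block and the pair in the upper one then give
    triples of different colors. *)
Lemma block_no_new_copy j : ~ mono_copy (K 3 4) block_coloring (rshift t j).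
Proof.
case=> g g_inj gj; pose Q := g @: [set: K 3 4].
have cQ : #|Q| = 4 by rewrite card_imset // cardsT card_ord.
have Qj e : e \in draws 3 Q -> block_coloring e = rshift t j.
  case/(draws_imset (in2W g_inj))=> e' e'Q ->; apply: gj.
  by move: e'Q; rewrite !inE subsetT.
have [e0 e0Q] : exists e0, e0 \in draws 3 Q.
  by apply/card_gt0P; rewrite cards_draws cQ.
have [Q_inj|Q_block|[x [y [z [xQ yQ zQ xy [fxy fz]]]]]] := fiber_cases fst Q.
- have /eqP := Qj e0 e0Q.
  by rewrite (block_coloring_across Q_inj) // eq_lrshift.
- have /eqP := Qj e0 e0Q.
  by rewrite (block_coloring_inside Q_block) // eq_lrshift.
have [|w wQ [wx wy wz]] := @exists_fourth _ Q x y z; first by rewrite cQ.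
have fzy : z.1 != y.1 by rewrite -fxy.
have [zx zy] := (neq_fst fz, neq_fst fzy).
have xyzQ : [set x; y; z] \in draws 3 Q by apply: set3_draws; rewrite // eq_sym.
have [fwx|fwx] := eqVneq w.1 x.1.
  have xywQ : [set x; y; w] \in draws 3 Q by apply: set3_draws; rewrite // eq_sym.
  have /eqP := Qj _ xywQ.
  by rewrite /block_coloring imset_set3 -fxy fwx !setUid cards1 eq_lrshift.
have [fwz|fwz] := eqVneq w.1 z.1.
  have zwxQ : [set z; w; x] \in draws 3 Q by apply: set3_draws; rewrite // eq_sym.
  have := Qj _ zwxQ; rewrite -(Qj _ xyzQ).
  rewrite !block_coloring_split // 1?eq_sym // => /rshift_inj.
  by move: fz; rewrite -val_eqE /=; case: ltngtP.
have xzwQ : [set x; z; w] \in draws 3 Q by apply: set3_draws; rewrite // eq_sym.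
have /eqP := Qj _ xzwQ.
by rewrite block_coloring_three ?eq_lrshift // eq_sym.
Qed.

(** Near completeness with a fourth vertex is what excludes a copy that meets
    several blocks but repeats one: only one of its triples may meet exactly
    two blocks, whereas two vertices [x], [y] of a block, a vertex [z] outside
    and any further [w] always produce two such triples. *)
Lemma block_no_old_copy (G : hypergraph 3) i :
    nearly_complete G -> 3 < #|G| ->
  mono_copy G block_coloring (lshift 2 i) -> mono_copy G d i.
Proof.
move=> [e0 e0P] cG [g g_inj gi].
have copy_draws (e : {set G}) : e \in edge G -> g @: e \in draws 3 (g @: [set: G]).
  move=> eG; rewrite inE imsetS ?subsetT //= card_imset //.
  by rewrite (edge_uniform eG).
(* Such a triple meets exactly two blocks, so its color is new and not [lshift 2 i]. *)
have missing (x y z : G) : x != y -> (g x).1 = (g y).1 -> (g z).1 != (g x).1 ->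
    [set x; y; z] = e0.
  move=> xy fxy fz; apply/eqP; apply: contraT => /e0P eG.
  have zx : z != x by apply: contraNneq fz => ->.
  have zy : z != y by apply: contraNneq fz => ->; rewrite fxy.
  have /eqP : block_coloring (g @: [set x; y; z]) = lshift 2 i.
    by apply/gi/eG; rewrite card_set3 // eq_sym.
  by rewrite imset_set3 block_coloring_split ?(inj_eq g_inj) // eq_rlshift.
have [f_inj|f_block|[x [y [z [_ _ _ xy [fxy fz]]]]]] :=
    fiber_cases (fst \o g) [set: G].
- exists (fst \o g); first by move=> x y; apply: f_inj; rewrite inE.
  move=> e eG; have Q_inj : {in g @: [set: G] &, injective fst}.
    by move=> _ _ /imsetP[x _ ->] /imsetP[y _ ->] /f_inj ->; rewrite ?inE.
  apply: (@lshift_inj _ 2); rewrite -(gi e eG) imset_comp.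
  by rewrite (block_coloring_across Q_inj) ?copy_draws.
- have Q_block : {in g @: [set: G] &, forall x y, x.1 = y.1}.
    by move=> _ _ /imsetP[x _ ->] /imsetP[y _ ->]; apply: f_block; rewrite inE.
  exists (snd \o g) => [x y /= E|e eG].
    apply: g_inj; rewrite [LHS]surjective_pairing [RHS]surjective_pairing E.
    by congr (_, _); apply: f_block; rewrite inE.
  apply: (@lshift_inj _ 2); rewrite -(gi e eG) imset_comp.
  by rewrite (block_coloring_inside Q_block) ?copy_draws.
have [|w _ [wx wy wz]] := @exists_fourth _ [set: G] x y z.
  by rewrite cardsT.
(* [w] lies outside the missing hyperedge [set x; y; z], so it must share the
   block of [x], and then [set w; x; z] is a second missing hyperedge. *)
have e0xyz := missing x y z xy fxy fz.
have w_e0 : w \notin e0 by rewrite -e0xyz !inE !negb_or wx wy wz.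
have fw : (g w).1 = (g x).1.
  apply/eqP; apply: contraT => fw.
  by rewrite -(missing x y w xy fxy fw) !inE eqxx orbT in w_e0.
by rewrite -(missing w x z wx fw) ?fw // !inE eqxx in w_e0.
Qed.

End BlockColoring.

(** * Lower bounds on Gallai-Ramsey numbers *)

Lemma gr_le r t (H : 'I_t -> hypergraph r) p :
  gallai_arrows H p -> gr H <= p.
Proof. by move=> /asboolP arr; rewrite /gr; case: ex_minnP => m _; apply. Qed.

Lemma gallai_arrows_gr r t (H : 'I_t -> hypergraph r) : gallai_arrows H (gr H).
Proof. by rewrite /gr; case: ex_minnP => m /asboolP. Qed.

(** Makes [gr H - 1] a genuine predecessor. *)
Lemma not_gallai_arrows0 r t (H : 'I_t -> hypergraph r) :
  0 < t -> (forall i, 0 < #|H i|) -> ~ gallai_arrows H 0.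
Proof.
move=> t_gt0 H_gt0 /(gallai_arrowsE _ _ t_gt0)/(_ (fun=> Ordinal t_gt0)) [].
  by move=> Q cQ; have := max_card (mem Q); rewrite cQ card_ord.
by move=> i [g /leq_card]; rewrite card_ord leqNgt H_gt0.
Qed.

Lemma exists_gallai_avoiding r t (H : 'I_t -> hypergraph r) p :
    0 < t -> p < gr H ->
  exists2 d : {set 'I_p} -> 'I_t, set_gallai r d &
    forall i, ~ mono_copy (H i) d i.
Proof.
move=> t_gt0 lt_p; apply: contrapT => no_d.
have : gr H <= p.
  apply: gr_le; apply/(gallai_arrowsE _ _ t_gt0) => d dG.
  apply: contrapT => no_i; apply: no_d; exists d => // i iH.
  by apply: no_i; exists i.
by rewrite leqNgt lt_p.
Qed.

Theorem theorem8 (t : nat) (H : 'I_t -> hypergraph 3)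
  (t_ge1 : 1 <= t)
  (order_gt3 : forall i : 'I_t, 3 < #|H i|)
  (H_shape : forall i : 'I_t,
     (exists n : nat, isomorphic (H i) (K 3 n)) \/
     (exists (n : nat) (e : {set K 3 n}),
        e \in edge (K 3 n) /\ isomorphic (H i) (del_edge e))) :
  (gr H - 1) ^ 2 + 1 <=
    gr (cat_family H (fun _ : 'I_2 => K 3 4)).
Proof.
have H_near i : nearly_complete (H i).
  case: (H_shape i) => [[n Hn]|[n [e [_ He]]]].
    exact: isomorphic_nearly_complete Hn (K_nearly_complete 3 n).
  exact: isomorphic_nearly_complete He (del_edge_nearly_complete e).
have gr_gt0 : 0 < gr H.
  rewrite lt0n; apply/eqP => gr0.
  apply: (@not_gallai_arrows0 _ _ H) => // [i|].
    exact: leq_trans (order_gt3 i).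
  by have := @gallai_arrows_gr _ _ H; rewrite gr0.
set m := gr H - 1.
have [|d dG d_avoids] := @exists_gallai_avoiding _ _ H m t_ge1.
  by rewrite /m subn1 ltn_predL.
set p := gr (cat_family _ _); rewrite addn1 ltnNge; apply/negP => le_p.
(* The definition of [gr] does not give monotonicity of arrowing, so the block
   coloring is restricted to exactly [p] of its points. *)
have le_card : p <= #|{: 'I_m * 'I_m}| by rewrite card_prod card_ord mulnn.
pose h (i : 'I_p) : 'I_m * 'I_m := enum_val (widen_ord le_card i).
have h_inj : injective h by move=> i j /enum_val_inj/(congr1 val)/= /val_inj.
have t2_gt0 : 0 < t + 2 by rewrite addn2.
have /(gallai_arrowsE _ _ t2_gt0) arr :=
  @gallai_arrows_gr _ _ (cat_family H (fun _ : 'I_2 => K 3 4)).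
have [i] := arr _ (set_gallai_pullback h_inj (block_gallai dG)).
move/(mono_copy_pullback h_inj).
have [j ->|j ->] := split_ordP i; rewrite /cat_family.
  rewrite (unsplitK (inl j)) => /block_no_old_copy copy.
  exact/(d_avoids j)/copy.
by rewrite (unsplitK (inr j)); apply: block_no_new_copy.
Qed.
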